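(* Consider the two-sorted structure $M=((M_1,S_1,\{g^1_{1/n}\mid n\ge1\}),(M_2,S_2,\{g^2_{1/n}\mid n\ge1\}),\delta)$, where $M_1,M_2$ are the unit circles centered at the origins of two disjoint real planes; $S_i$ is the ternary relation on $M_i$ such that $S_i(b,c,d)$ holds iff $b,c,d$ are in clockwise order; $g^i_{1/n}:M_i\to M_i$ is clockwise rotation by $2\pi/n$ radians; and $\delta:M_1\to M_2$ is the double covering $\delta(\cos t,\sin t)=(\cos 2t,\sin 2t)$. Let $\mathcal M$ be a monster model of $\operatorname{Th}(M)$ with sorts $\mathcal M_1,\mathcal M_2$. For $i=1,2$ let $E_i$ be the $\emptyset$-type-definable equivalence relation on $\mathcal M_i$ of being infinitesimally close, $$E_i(x,y):=\bigwedge_{1<n}\bigl(S_i(x,y,g^i_{1/n}(x))\vee S_i(y,x,g^i_{1/n}(y))\bigr).$$ Let $c\in\mathcal M_2$. Then $\operatorname{acl}(c/E_2)$ and $\operatorname{acl}^{\operatorname{eq}}(c/E_2)$ are not interdefinable.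
   Context: A hyperimaginary is a class $b/F$ of a real tuple $b$ from $\mathcal M$ modulo an $\emptyset$-type-definable equivalence relation $F$. For a hyperimaginary $\boldsymbol e$, $\operatorname{Aut}_{\boldsymbol e}(\mathcal M)=\{f\in\operatorname{Aut}(\mathcal M):f(\boldsymbol e)=\boldsymbol e\}$. $\boldsymbol e'\in\operatorname{acl}(\boldsymbol e)$ means that the hyperimaginary $\boldsymbol e'$ has only finitely many images under $\operatorname{Aut}_{\boldsymbol e}(\mathcal M)$; as a set, $\operatorname{acl}(\boldsymbol e)$ consists of all countable hyperimaginaries ($b/F$ with $|b|$ countable) with this property. $\operatorname{acl}^{\operatorname{eq}}(\boldsymbol e)=\{\boldsymbol e\}\cup(\operatorname{acl}(\boldsymbol e)\cap\mathcal M^{\operatorname{eq}})$, where $\mathcal M^{\operatorname{eq}}$ is the set of imaginary elements (classes of $\emptyset$-definable equivalence relations). Two sets of hyperimaginaries are interdefinable if an automorphism of $\mathcal M$ fixes every member of the first iff it fixes every member of the second. In the definition of $E_i$, the relation $S_i$ is to be read in the non-strict sense when $x=y$, so that $E_i$ is reflexive. *)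

(* Defs.v *)
From HB Require Import structures.
From Stdlib Require Import RelationClasses.
From mathcomp Require Import all_boot all_order all_algebra.
From mathcomp Require Import boolp classical_sets functions cardinality.
From mathcomp Require Import reals topology normedtype sequences trigo.
From mathcomp Require Import ring lra.

Set Implicit Arguments.
Unset Strict Implicit.
Unset Printing Implicit Defensive.

Import Order.TTheory GRing.Theory Num.Theory.
Local Open Scope classical_set_scope.
Local Open Scope card_scope.

Record signature := Signature {
  lsort : Type;
  fsym : Type;
  farity : fsym -> nat;
  fdom : forall f : fsym, 'I_(farity f) -> lsort;
  fcod : fsym -> lsort;
  rsym : Type;
  rarity : rsym -> nat;
  rdom : forall r : rsym, 'I_(rarity r) -> lsort }.

Record structure (L : signature) := Structure {
  carrier :> lsort L -> Type;
  fint : forall f : fsym L,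
    (forall i : 'I_(farity f), carrier (fdom i)) -> carrier (fcod f);
  rint : forall r : rsym L,
    (forall i : 'I_(rarity r), carrier (rdom i)) -> Prop }.

(** Terms and formulas have their free variables in an arbitrary type [V],
    with sorts given by [sv]; a quantifier adds the variable [None]. *)
Definition ext S (V : Type) (sv : V -> S) (s : S) : option V -> S :=
  fun o => if o is Some x then sv x else s.

Inductive term (L : signature) (V : Type) (sv : V -> lsort L) :
    lsort L -> Type :=
| tVar (x : V) : term sv (sv x)
| tApp (f : fsym L) (a : forall i : 'I_(farity f), term sv (fdom i)) :
    term sv (fcod f).

Inductive formula (L : signature) (V : Type) (sv : V -> lsort L) : Type :=
| fEq (s : lsort L) (t u : term sv s)
| fRel (r : rsym L) (a : forall i : 'I_(rarity r), term sv (rdom i))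
| fBot
| fImp (p q : formula sv)
| fAll (s : lsort L) (p : formula (ext sv s)).
Arguments fBot {L V sv}.

Definition fOr (L : signature) V (sv : V -> lsort L) (p q : formula sv) :=
  fImp (fImp p fBot) q.

Definition no_sort (L : signature) : void -> lsort L :=
  fun x => match x with end.

Definition sentence (L : signature) := formula (@no_sort L).

(** Tuples of sort [sv]; also used as assignments of the variables [V]. *)
Definition tuple_of (L : signature) (M : structure L) V (sv : V -> lsort L) :=
  forall x : V, M (sv x).

Definition snoc (L : signature) (M : structure L) V (sv : V -> lsort L) s
    (v : tuple_of M sv) (a : M s) : tuple_of M (ext sv s) :=
  fun o => match o with Some x => v x | None => a end.

Fixpoint teval (L : signature) (M : structure L) V (sv : V -> lsort L)
    (v : tuple_of M sv) s (t : term sv s) : M s :=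
  match t with
  | tVar x => v x
  | tApp f a => fint (fun i => teval v (a i))
  end.

Fixpoint sat (L : signature) (M : structure L) V (sv : V -> lsort L)
    (v : tuple_of M sv) (p : formula sv) {struct p} : Prop :=
  match p with
  | fEq _ t u => teval v t = teval v u
  | fRel r a => rint (fun i => teval v (a i))
  | fBot => False
  | fImp p q => sat v p -> sat v q
  | fAll s p => forall a : M s, sat (snoc v a) p
  end.

Definition empty_tuple (L : signature) (M : structure L) :
  tuple_of M (@no_sort L) := fun x => match x with end.

Definition true_in (L : signature) (M : structure L) (p : sentence L) :=
  sat (empty_tuple M) p.

Definition Th (L : signature) (M : structure L) : set (sentence L) :=
  [set p | true_in M p].

Definition models (L : signature) (T : set (sentence L)) (M : structure L) :=
  forall p, T p -> true_in M p.

Definition Aut (L : signature) (M : structure L) :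
    set (forall s, M s -> M s) :=
  [set f : forall s, M s -> M s | [/\ forall s, bijective (f s),
    forall (g : fsym L) a, f _ (fint (f := g) a) = fint (fun i => f _ (a i)) &
    forall (r : rsym L) a, rint (r := r) a <-> rint (fun i => f _ (a i))]].
Arguments Aut {L} M _.

Definition tuple_map (L : signature) (M : structure L) V (sv : V -> lsort L)
    (f : forall s, M s -> M s) (a : tuple_of M sv) : tuple_of M sv :=
  fun i => f _ (a i).

Definition smaller (A K : Type) : Prop :=
  [set: A] #<= [set: K] /\ ~ ([set: K] #<= [set: A]).

(** The cardinal kappa is that of the type [K]. A set of parameters is given as a
    family [a], so that a formula over [a] in one free variable is a formula
    in the context [ext sA s]. *)
Definition saturated (L : signature) (K : Type) (M : structure L) :=
  forall (A : Type) (sA : A -> lsort L) (a : tuple_of M sA), smaller A K ->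
  forall (s : lsort L) (p : set (formula (ext sA s))),
    (forall p0, p0 `<=` p -> finite_set p0 ->
       exists b : M s, forall q, p0 q -> sat (snoc a b) q) ->
    exists b : M s, forall q, p q -> sat (snoc a b) q.

Definition strongly_homogeneous (L : signature) (K : Type)
    (M : structure L) :=
  forall (A : Type) (sA : A -> lsort L) (a b : tuple_of M sA), smaller A K ->
    (forall q : formula sA, sat a q <-> sat b q) ->
    exists2 f, Aut M f & tuple_map f a = b.

Record monster (L : signature) (T : set (sentence L)) (K : Type)
    (M : structure L) : Prop := Monster {
  monster_models : models T M;
  monster_card : smaller (sentence L) K;
  monster_saturated : saturated K M;
  monster_homogeneous : strongly_homogeneous K M }.

Definition twice S (V : Type) (sv : V -> S) : V + V -> S :=
  fun o => match o with inl x => sv x | inr x => sv x end.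

Definition pair_up (L : signature) (M : structure L) V (sv : V -> lsort L)
    (a b : tuple_of M sv) : tuple_of M (twice sv) :=
  fun o => match o with inl x => a x | inr x => b x end.

(** The relation between tuples that is defined by a partial type
    over the empty set. *)
Definition type_rel (L : signature) (M : structure L) V (sv : V -> lsort L)
    (F : set (formula (twice sv))) (a b : tuple_of M sv) : Prop :=
  forall q, F q -> sat (pair_up a b) q.

Definition type_class (L : signature) (M : structure L) V (sv : V -> lsort L)
    (F : set (formula (twice sv))) (a : tuple_of M sv) : set (tuple_of M sv) :=
  [set b | type_rel F a b].

Record hyperimaginary (L : signature) (M : structure L) := Hyper {
  hidx : Type;
  hsort : hidx -> lsort L;
  htuple : tuple_of M hsort;
  hrel : set (formula (twice hsort));
  hequiv : Equivalence (@type_rel L M _ hsort hrel) }.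

Arguments hidx {L M} h.
Arguments hsort {L M} h _.
Arguments htuple {L M} h _.
Arguments hrel {L M} h _.

Definition hclass (L : signature) (M : structure L) (e : hyperimaginary M) :=
  type_class (hrel e) (htuple e).
Arguments hclass {L M} e _.

(** [f (b / F) = f b / F], as a class. *)
Definition himage (L : signature) (M : structure L)
    (f : forall s, M s -> M s) (e : hyperimaginary M) :=
  type_class (hrel e) (tuple_map f (htuple e)).
Arguments himage {L M} f e _.

Definition fixes (L : signature) (M : structure L)
    (f : forall s, M s -> M s) (e : hyperimaginary M) : Prop :=
  himage f e = hclass e.

Definition Aut_over (L : signature) (M : structure L)
    (e : hyperimaginary M) : set (forall s, M s -> M s) :=
  [set f | Aut M f /\ fixes f e].
Arguments Aut_over {L M} e _.

Definition acl (L : signature) (M : structure L) (e : hyperimaginary M) :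
    set (hyperimaginary M) :=
  [set e' | countable [set: hidx e'] /\
            finite_set [set himage f e' | f in Aut_over e]].
Arguments acl {L M} e _.

Definition Meq (L : signature) (M : structure L) : set (hyperimaginary M) :=
  [set e | finite_set [set: hidx e] /\
     exists q : formula (twice (hsort e)),
       forall a b : tuple_of M (hsort e),
         type_rel (hrel e) a b <-> sat (pair_up a b) q].
Arguments Meq {L} M _.

Definition acleq (L : signature) (M : structure L) (e : hyperimaginary M) :
    set (hyperimaginary M) :=
  [set e] `|` (acl e `&` Meq M).
Arguments acleq {L M} e _.

Definition interdefinable (L : signature) (M : structure L)
    (A B : set (hyperimaginary M)) : Prop :=
  forall f, Aut M f ->
    (forall e, A e -> fixes f e) <-> (forall e, B e -> fixes f e).

Inductive circle_sort := One | Two.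

(** [Rot i k] is the symbol for the rotation by [2 pi / (k + 1)]. *)
Inductive circle_fsym := Rot (i : circle_sort) (k : nat) | Cover.

Definition circle_sig : signature := {|
  lsort := circle_sort;
  fsym := circle_fsym;
  farity := fun=> 1;
  fdom := fun f _ => if f is Rot i _ then i else One;
  fcod := fun f => if f is Rot i _ then i else Two;
  rsym := circle_sort;
  rarity := fun=> 3;
  rdom := fun i _ => i |}.

Section Circle.
Local Open Scope ring_scope.
Variable R : realType.

Definition on_circle (p : R * R) : bool := p.1 ^+ 2 + p.2 ^+ 2 == 1.

Definition circle : Type := {p : R * R | on_circle p}.

Lemma at_angle_subproof (t : R) : on_circle (cos t, sin t).
Proof. by rewrite /on_circle cos2Dsin2. Qed.

Definition at_angle (t : R) : circle :=
  exist on_circle (cos t, sin t) (at_angle_subproof t).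

Definition rotate_pt (w : R) (p : R * R) : R * R :=
  (p.1 * cos w + p.2 * sin w, p.2 * cos w - p.1 * sin w).

Lemma rotate_subproof w (p : circle) : on_circle (rotate_pt w (val p)).
Proof.
case: p => -[x y] /= /eqP /= h; apply/eqP => /=.
transitivity ((x ^+ 2 + y ^+ 2) * (cos w ^+ 2 + sin w ^+ 2)); first by ring.
by rewrite h cos2Dsin2 mulr1.
Qed.

(** Clockwise rotation by [w] radians, see [rotate_at]. *)
Definition rotate (w : R) (p : circle) : circle :=
  exist on_circle (rotate_pt w (val p)) (rotate_subproof w p).

Lemma rotate_at w t : rotate w (at_angle t) = at_angle (t - w).
Proof.
apply: val_inj; rewrite /= /rotate_pt /= cosB sinB.
by congr pair; ring.
Qed.

Definition double_pt (p : R * R) : R * R :=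
  (p.1 ^+ 2 - p.2 ^+ 2, 2 * p.1 * p.2).

Lemma double_subproof (p : circle) : on_circle (double_pt (val p)).
Proof.
case: p => -[x y] /= /eqP /= h; apply/eqP => /=.
by transitivity ((x ^+ 2 + y ^+ 2) ^+ 2); [ring | rewrite h expr1n].
Qed.

(** The double covering, in Cartesian coordinates, see [double_at]. *)
Definition double_cover (p : circle) : circle :=
  exist on_circle (double_pt (val p)) (double_subproof p).

Lemma double_at t : double_cover (at_angle t) = at_angle (2 * t).
Proof.
apply: val_inj; rewrite /= /double_pt /= (_ : 2 * t = t + t); last by ring.
rewrite cosD sinD.
by congr pair; ring.
Qed.

(** Strict: [b], [c], [d] are distinct, and going clockwise from [b]
    one meets [c] before [d]. *)
Definition clockwise (b c d : circle) : Prop :=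
  exists t u v : R, [/\ 0 < u, u < v, v < 2 * pi &
    [/\ b = at_angle t, c = at_angle (t - u) & d = at_angle (t - v)]].

Definition circle_structure : structure circle_sig :=
  @Structure circle_sig (fun=> circle)
    (fun f a => match f with
                | Rot _ k => rotate (2 * pi / k.+1%:R) (a ord0)
                | Cover => double_cover (a ord0)
                end)
    (fun _ a => clockwise (a (@Ordinal 3 0 isT)) (a (@Ordinal 3 1 isT))
                          (a (@Ordinal 3 2 isT))).

End Circle.

Definition rot_term V (sv : V -> circle_sort) (i : circle_sort) (k : nat)
    (x : @term circle_sig V sv i) : @term circle_sig V sv i :=
  @tApp circle_sig V sv (Rot i k) (fun=> x).

Definition clockwise_fm V (sv : V -> circle_sort) (i : circle_sort)
    (x y z : @term circle_sig V sv i) : @formula circle_sig V sv :=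
  @fRel circle_sig V sv i
    (fun j => match val j with 0 => x | 1 => y | _ => z end).

(** The conjunct of [E_i = inf_close i] for [n = k + 2]. The disjunct [x = y] is the
    non-strict reading of [S_i (x, x, _)]. *)
Definition close_fm (i : circle_sort) (k : nat) V (sv : V -> circle_sort)
    (x y : @term circle_sig V sv i) : @formula circle_sig V sv :=
  fOr (fEq x y)
    (fOr (clockwise_fm x y (rot_term k.+1 x))
         (clockwise_fm y x (rot_term k.+1 y))).

Definition inf_close (i : circle_sort) :
    set (@formula circle_sig _ (twice (fun _ : unit => i))) :=
  range (fun k => close_fm k
    (@tVar circle_sig _ (twice (fun _ : unit => i)) (inl tt))
    (@tVar circle_sig _ (twice (fun _ : unit => i)) (inr tt))).
Arguments inf_close i _ : clear implicits.

Definition cw (N : structure circle_sig) i (a b c : N i) : Prop :=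
  @rint circle_sig N i (fun j => match val j with 0 => a | 1 => b | _ => c end).

Definition rot (N : structure circle_sig) i k (a : N i) : N i :=
  @fint circle_sig N (Rot i k) (fun=> a).

Definition close (N : structure circle_sig) i k (a b : N i) : Prop :=
  [\/ a = b, cw a b (rot k.+1 a) | cw b a (rot k.+1 b)].

Lemma sat_clockwise_fm (N : structure circle_sig) V (sv : V -> circle_sort)
    (v : @tuple_of circle_sig N V sv) i (x y z : @term circle_sig V sv i) :
  sat v (clockwise_fm x y z) <-> cw (teval v x) (teval v y) (teval v z).
Proof.
rewrite /cw /=; set g := (X in rint X); set h := (X in _ <-> rint X).
suff -> : g = h by [].
by apply: functional_extensionality_dep => -[[|[|m]] hm].
Qed.

Lemma sat_close_fm (N : structure circle_sig) V (sv : V -> circle_sort)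
    (v : @tuple_of circle_sig N V sv) i k (x y : @term circle_sig V sv i) :
  sat v (close_fm k x y) <-> close k (teval v x) (teval v y).
Proof.
pose A := teval v x = teval v y.
pose B := sat v (clockwise_fm x y (rot_term k.+1 x)).
pose C := sat v (clockwise_fm y x (rot_term k.+1 y)).
have -> : sat v (close_fm k x y) = ((A -> False) -> (B -> False) -> C) by [].
have hB : B <-> cw (teval v x) (teval v y) (rot k.+1 (teval v x)).
  exact: sat_clockwise_fm.
have hC : C <-> cw (teval v y) (teval v x) (rot k.+1 (teval v y)).
  exact: sat_clockwise_fm.
rewrite /close -/A -(propext hB) -(propext hC); split=> [h|[]//].
have [a|na] := pselect A; first exact: Or31.
have [b|nb] := pselect B; first exact: Or32.
by apply: Or33; apply: h.
Qed.

Section StandardClose.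
Local Open Scope ring_scope.
Variable R : realType.

Lemma at_angleD2pi (t : R) : at_angle (t + 2 * pi) = at_angle t.
Proof.
by apply: val_inj; rewrite /= mulr_natl cosD2pi sinD2pi.
Qed.

Lemma at_angle_inj0 (t u : R) : 0 < u < 2 * pi ->
  at_angle t <> at_angle (t - u).
Proof.
move=> /andP[u0 u2] /(congr1 val) /= [hc hs].
have c1 : cos u = 1.
  rewrite (_ : u = t - (t - u)); last by ring.
  by rewrite cosB -hc -hs -!expr2 cos2Dsin2.
have cE : cos u = 1 - sin (u / 2) ^+ 2 *+ 2.
  rewrite [in LHS](_ : u = u / 2 + u / 2); last by field.
  by rewrite cosD -!expr2 cos2sin2; ring.
have s0 : 0 < sin (u / 2).
  by apply: sin_gt0_pi; rewrite divr_gt0 //= ltr_pdivrMr // mulrC.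
have := exprn_gt0 2 s0; lra.
Qed.

Lemma at_angle_inj (t u v : R) : 0 < u < 2 * pi -> 0 < v < 2 * pi ->
  at_angle (t - u) = at_angle (t - v) -> u = v.
Proof.
move=> /andP[u0 u2] /andP[v0 v2] h.
have [uv|vu|//] := ltgtP u v.
- exfalso; apply: (@at_angle_inj0 (t - u) (v - u)); first by apply/andP; split; lra.
  by rewrite h; congr at_angle; ring.
- exfalso; apply: (@at_angle_inj0 (t - v) (u - v)); first by apply/andP; split; lra.
  by rewrite -h; congr at_angle; ring.
Qed.

Lemma angle_bounds (k : nat) : 0 < 2 * pi / k.+2%:R :> R /\
  2 * pi / k.+2%:R < 2 * pi :> R.
Proof.
have p0 : 0 < 2 * pi :> R by have := pi_gt0 R; lra.
split; first by rewrite divr_gt0.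
by rewrite ltr_pdivrMr // ltr_pMr // ltr1n.
Qed.

Lemma cw_rotP i k (a b : circle_structure R i) :
  cw a b (rot k.+1 a) <->
  exists t u : R, [/\ 0 < u, u < 2 * pi / k.+2%:R,
    a = at_angle t & b = at_angle (t - u)].
Proof.
have [w0 w2] := angle_bounds k.
split.
- move=> [t [u [v [u0 uv v2 /= [ha hb hr]]]]].
  exists t, u; split=> //.
  have -> // : 2 * pi / k.+2%:R = v.
  move: hr; rewrite ha /= rotate_at; apply: at_angle_inj; first by rewrite w0.
  by rewrite (lt_trans u0).
- move=> [t [u [u0 uw -> ->]]].
  exists t, u, (2 * pi / k.+2%:R); split=> //; split=> //.
  by rewrite /= rotate_at.
Qed.

Lemma at_angle_ex (p : circle R) : exists t, p = at_angle t.
Proof.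
case: p => -[x y] hp; have /eqP /= h := hp.
have x1 : -1 <= x <= 1 by apply/andP; split; nra.
have y2 : Num.sqrt (1 - x ^+ 2) = `|y| by rewrite -h addrC addKr sqrtr_sqr.
have [y0|y0] := leP 0 y.
- exists (acos x); apply: val_inj => /=.
  by rewrite acosK ?in_itv //= sin_acos // y2 ger0_norm.
- exists (- acos x); apply: val_inj => /=.
  by rewrite cosN sinN acosK ?in_itv //= sin_acos // y2 ltr0_norm // opprK.
Qed.

Lemma closeP i k (a b : circle_structure R i) :
  close k a b <->
  exists t u : R, [/\ `|u| < 2 * pi / k.+2%:R,
    a = at_angle t & b = at_angle (t - u)].
Proof.
have [w0 w2] := angle_bounds k.
split.
- move=> [<-|/cw_rotP [t [u [u0 uw ha hb]]]|/cw_rotP [t [u [u0 uw hb ha]]]].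
  + have [t ->] := at_angle_ex a.
    by exists t, 0; rewrite subr0 normr0.
  + by exists t, u; split=> //; rewrite gtr0_norm.
  + exists (t - u), (- u); split=> //; first by rewrite normrN gtr0_norm.
    by rewrite hb opprK subrK.
- move=> [t [u [uw -> ->]]].
  have [u0|u0|->] := ltgtP u 0.
  + apply: Or33; apply/cw_rotP; exists (t - u), (- u).
    by split=> //; [lra | rewrite -ltr0_norm | rewrite opprK subrK].
  + apply: Or32; apply/cw_rotP; exists t, u.
    by split=> //; rewrite -(gtr0_norm u0).
  + by apply: Or31; rewrite subr0.
Qed.

Lemma close_halve i k (a b c : circle_structure R i) :
  close (2 * k).+2 a b -> close (2 * k).+2 b c -> close k a c.
Proof.
move=> /closeP[t [u [hu -> ->]]] /closeP[t' [u' [hu' htt' ->]]].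
have half : 2 * pi / (2 * k).+4%:R = 2 * pi / k.+2%:R / 2 :> R.
  rewrite (_ : (2 * k).+4 = k.+2 * 2)%N; last by rewrite [in RHS]mulnC !mulnS.
  by rewrite natrM invfM mulrA.
apply/closeP; exists t, (u + u'); split=> //.
  apply: le_lt_trans (ler_normD _ _) _.
  by move: hu hu'; rewrite half; move: (_ / k.+2%:R) => w; lra.
have := congr1 (rotate u') htt'.
by rewrite !rotate_at opprD addrA => ->.
Qed.

Definition halve_fm (i : circle_sort) (k : nat) : sentence circle_sig :=
  @fAll circle_sig _ _ i (@fAll circle_sig _ _ i (@fAll circle_sig _ _ i
    (let sv := ext (ext (ext (@no_sort circle_sig) i) i) i in
     let x := @tVar circle_sig _ sv (Some (Some None)) in
     let y := @tVar circle_sig _ sv (Some None) in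
     let z := @tVar circle_sig _ sv None in
     fImp (close_fm (i := i) (2 * k).+2 x y)
       (fImp (close_fm (i := i) (2 * k).+2 y z) (close_fm (i := i) k x z))))).

Lemma true_halve_fm (N : structure circle_sig) i k :
  true_in N (halve_fm i k) <->
  forall a b c : N i,
    close (2 * k).+2 a b -> close (2 * k).+2 b c -> close k a c.
Proof.
pose sv := ext (ext (ext (@no_sort circle_sig) i) i) i.
pose x := @tVar circle_sig _ sv (Some (Some None)).
pose y := @tVar circle_sig _ sv (Some None).
pose z := @tVar circle_sig _ sv None.
have step a b c :
    let v := snoc (snoc (snoc (empty_tuple N) a) b) c in
    (sat v (close_fm (i := i) (2 * k).+2 x y) ->
     sat v (close_fm (i := i) (2 * k).+2 y z) ->
     sat v (close_fm (i := i) k x z)) <->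
    (close (2 * k).+2 a b -> close (2 * k).+2 b c -> close k a c).
  move=> v; have e1 := propext (sat_close_fm v (2 * k).+2 x y).
  have e2 := propext (sat_close_fm v (2 * k).+2 y z).
  have e3 := propext (sat_close_fm v k x z).
  by rewrite e1 e2 e3.
by split=> h a b c; [apply: (step a b c).1 | apply: (step a b c).2]; exact: h.
Qed.

Lemma type_rel_inf_close (N : structure circle_sig) i
    (a b : @tuple_of circle_sig N unit (fun=> i)) :
  type_rel (inf_close i) a b <-> forall k, close k (a tt) (b tt).
Proof.
split=> [h k|h _ [k _ <-]]; last by apply/sat_close_fm; exact: h.
have /sat_close_fm := h _ (ex_intro2 _ _ k I erefl); exact.
Qed.

Lemma inf_close_equiv (N : structure circle_sig) (i : circle_sort) :
  models (Th (circle_structure R)) N ->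
  Equivalence (@type_rel circle_sig N _ _ (inf_close i)).
Proof.
move=> hN; split=> [a|a b|a b c]; rewrite !(propext (type_rel_inf_close _ _)).
- by move=> k; apply: Or31.
- move=> h k; case: (h k) => [->|h1|h1]; [exact: Or31|exact: Or33|exact: Or32].
- move=> hab hbc k.
  have /true_halve_fm : true_in N (halve_fm i k).
    by apply: hN; apply/true_halve_fm => x y z; exact: close_halve.
  by apply; [exact: hab | exact: hbc].
Qed.

(** The hyperimaginary [c / E_i]. *)
Definition infinitesimal_class (N : structure circle_sig)
    (hN : models (Th (circle_structure R)) N) i (c : N i) :
    hyperimaginary N :=
  @Hyper circle_sig N unit (fun=> i) (fun=> c) (inf_close i) (inf_close_equiv i hN).

End StandardClose.

(* Main.v *)
From HB Require Import structures.
From mathcomp Require Import all_boot all_order all_algebra.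
From mathcomp Require Import boolp classical_sets functions cardinality.
From mathcomp Require Import reals topology trigo.
From mathcomp Require Import ring lra.
Require Import Defs.

Set Implicit Arguments.
Unset Strict Implicit.
Unset Printing Implicit Defensive.

Import Order.TTheory GRing.Theory Num.Theory.
Local Open Scope classical_set_scope.
Local Open Scope card_scope.

(** The separating automorphism is the deck transformation of the double
    covering: rotation by [pi] on the first circle, the identity on the second.
    It is definable, so it is an automorphism of every model.

    It moves a member of [acl e]. Choose [b] with [delta b = c]. An automorphism
    that fixes [c / E_2] sends [b] infinitesimally close to [b] or to its
    antipode ([model_close_lift]), so [b / E_1] has at most two images; the deck
    transformation exchanges them, and they differ
    ([model_antipode_not_close]).

    It fixes every member of [acleq e]: it fixes [c], hence [e]. Rotating by
    [2 pi / 2 ^ (k + 1)] on the first circle, and by twice that angle on the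
    second, gives definable automorphisms [turn k], with [turn 0] the deck
    transformation and [turn k.+1] a square root of [turn k].
    They move [c] by angles that tend to 0, so a limit of them, taken by
    saturation, fixes [c / E_2], although no single [turn k] with [k > 0] does.
    Let [d = a / F] be an imaginary. If the classes of the tuples [turn k a] are
    pairwise distinct, then every class differs from that of [turn k a] for all
    [k] but at most one, so the limit can be made to send [d] away from any
    countable list of classes fixed in advance, since a difference of classes
    is here expressed by one formula; hence [d] is not algebraic over [e]
    ([acl_imaginary_recurs]). So for [d] in [acl e] two of the classes agree.
    Repeated squaring of that coincidence shows that [turn 0] fixes [d]
    ([recurs_fixed]). The argument fails for [b / E_1], where a difference of
    classes is only an infinite disjunction of formulas. *)

(** * Formulas: connectives, substitution, automorphisms *)

Definition fNot (L : signature) V (sv : V -> lsort L) (p : formula sv) :=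
  fImp p fBot.

Definition fAnd (L : signature) V (sv : V -> lsort L) (p q : formula sv) :=
  fNot (fImp p (fNot q)).

Definition fEx (L : signature) V (sv : V -> lsort L) s
    (p : formula (ext sv s)) : formula sv :=
  fNot (fAll (fNot p)).

Section Syntax.
Variables (L : signature) (N : structure L).

Lemma sat_fAnd V (sv : V -> lsort L) (v : tuple_of N sv) (p q : formula sv) :
  sat v (fAnd p q) <-> sat v p /\ sat v q.
Proof.
split=> [h|[hp hq] h]; last exact: h.
by apply: contrapT => npq; apply: h => hp hq; apply: npq.
Qed.

Lemma sat_fOr V (sv : V -> lsort L) (v : tuple_of N sv) (p q : formula sv) :
  sat v (fOr p q) <-> sat v p \/ sat v q.
Proof.
split=> [h|[hp np|hq _ //]]; last by case: (np hp).
by have [hp|np] := pselect (sat v p); [left | right; apply: h].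
Qed.

Lemma sat_fEx V (sv : V -> lsort L) s (v : tuple_of N sv)
    (p : formula (ext sv s)) :
  sat v (fEx p) <-> exists b, sat (snoc v b) p.
Proof.
split=> [h|[b hb] h]; last exact: (h b).
by apply: contrapT => np; apply: h => b hb; apply: np; exists b.
Qed.

(** Substituting terms for variables, instead of renaming variables, needs no
    transport along equalities of sorts: [h x] has the sort of [x] by typing. *)
Fixpoint tsub V (sv : V -> lsort L) W (sw : W -> lsort L)
    (h : forall x, term sw (sv x)) s (t : term sv s) : term sw s :=
  match t with
  | tVar x => h x
  | tApp f a => tApp (fun i => tsub h (a i))
  end.

Definition tlift V (sv : V -> lsort L) W (sw : W -> lsort L)
    (h : forall x, term sw (sv x)) s (o : option V) :
    term (ext sw s) (ext sv s o) :=
  match o with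
  | Some x => tsub (fun y => @tVar L _ (ext sw s) (Some y)) (h x)
  | None => @tVar L _ (ext sw s) None
  end.

Fixpoint fsub V (sv : V -> lsort L) (p : formula sv) :
    forall W (sw : W -> lsort L), (forall x, term sw (sv x)) -> formula sw :=
  match p with
  | fEq _ t u => fun W sw h => fEq (tsub h t) (tsub h u)
  | fRel r a => fun W sw h => fRel (fun i => tsub h (a i))
  | fBot => fun W sw h => fBot
  | fImp p q => fun W sw h => fImp (fsub p h) (fsub q h)
  | fAll s p => fun W sw h => fAll (fsub p (tlift h s))
  end.

Lemma teval_tsub V (sv : V -> lsort L) W (sw : W -> lsort L)
    (h : forall x, term sw (sv x)) (v : tuple_of N sw) s (t : term sv s) :
  teval v (tsub h t) = teval (fun x => teval v (h x)) t.
Proof.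
elim: t => //= f a ih; congr fint.
by apply: functional_extensionality_dep => i; exact: ih.
Qed.

Lemma sat_fsub V (sv : V -> lsort L) (p : formula sv) W (sw : W -> lsort L)
    (h : forall x, term sw (sv x)) (v : tuple_of N sw) :
  sat v (fsub p h) <-> sat (fun x => teval v (h x)) p.
Proof.
elim: p W sw h v => {V sv} [V sv s t u|V sv r a|V sv|V sv p ihp q ihq|V sv s p ih]
  W sw h v //=.
- by rewrite !teval_tsub.
- suff -> : (fun i => teval v (tsub h (a i))) =
            (fun i => teval (fun x => teval v (h x)) (a i)) by [].
  by apply: functional_extensionality_dep => i; exact: teval_tsub.
- by rewrite (propext (ihp _ _ _ _)) (propext (ihq _ _ _ _)).
- have e b : (fun x => teval (snoc v b) (tlift h s x)) =
             snoc (fun x => teval v (h x)) b.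
    by apply: functional_extensionality_dep => -[x|] //=; rewrite teval_tsub.
  by split=> H b; [rewrite -e; apply/ih | apply/ih; rewrite e].
Qed.

Lemma teval_aut f V (sv : V -> lsort L) (v : tuple_of N sv) s (t : term sv s) :
  Aut N f -> teval (tuple_map f v) t = f _ (teval v t).
Proof.
case=> _ hf _; elim: t => //= g a ih; rewrite hf; congr fint.
by apply: functional_extensionality_dep => i; exact: ih.
Qed.

Lemma sat_aut f V (sv : V -> lsort L) (p : formula sv) (v : tuple_of N sv) :
  Aut N f -> sat (tuple_map f v) p <-> sat v p.
Proof.
move=> hf.
elim: p v => {V sv} [V sv s t u|V sv r a|V sv|V sv p ihp q ihq|V sv s p ih] v //=.
- rewrite !(teval_aut _ _ hf); split=> [|->//].
  by have [bf _ _] := hf; exact: bij_inj (bf s) _ _.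
- have -> : (fun i => teval (tuple_map f v) (a i)) =
             (fun i => f _ (teval v (a i))).
    by apply: functional_extensionality_dep => i; exact: teval_aut.
  have [_ _ hr] := hf; exact: iff_sym (hr r _).
- by rewrite (propext (ihp _)) (propext (ihq _)).
- have e b : snoc (tuple_map f v) (f s b) = tuple_map f (snoc v b).
    by apply: functional_extensionality_dep => -[x|].
  have [/(_ s)[g gK fK] _ _] := hf.
  split=> H b.
    by apply/ih; rewrite -e; exact: H.
  by rewrite -(fK b) e; apply/ih; exact: H.
Qed.

Lemma pair_up_map f V (sv : V -> lsort L) (a b : tuple_of N sv) :
  pair_up (tuple_map f a) (tuple_map f b) = tuple_map f (pair_up a b).
Proof. by apply: functional_extensionality_dep => -[]. Qed.

Lemma type_rel_aut f V (sv : V -> lsort L) F (a b : tuple_of N sv) : Aut N f ->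
  type_rel F (tuple_map f a) (tuple_map f b) <-> type_rel F a b.
Proof.
move=> hf; split=> h q /h; rewrite pair_up_map;
  [move/sat_aut | move=> hq; apply/sat_aut]; exact.
Qed.

Lemma himage_eq f g (e : hyperimaginary N) :
  himage f e = himage g e <->
  type_rel (hrel e) (tuple_map f (htuple e)) (tuple_map g (htuple e)).
Proof.
have [r s t] := hequiv e; split.
  move=> h; have : himage g e (tuple_map g (htuple e)) by exact: r.
  by rewrite -h.
move=> h; apply/seteqP; split=> x /= hx; first exact: t (s _ _ h) hx.
exact: t h hx.
Qed.

Lemma fixesE f (e : hyperimaginary N) :
  fixes f e <-> type_rel (hrel e) (tuple_map f (htuple e)) (htuple e).
Proof. exact: (himage_eq f (fun=> id) e). Qed.

Lemma aut_id : Aut N (fun=> id).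
Proof. by split=> // s; exists id. Qed.

End Syntax.

(** * Limits of tuples and of automorphisms *)

(** The set of sentences is infinite, and smaller than [K]. *)
Lemma countable_smaller (L : signature) (K A : Type) :
  smaller (sentence L) K -> countable [set: A] -> smaller A K.
Proof.
move=> [LK KL] cA.
have natL : [set: nat] #<= [set: sentence L].
  pose f n : sentence L := iter n (fImp fBot) fBot.
  pose U : pointedType := HB.pack {classic sentence L}
    (isPointed.Build {classic sentence L} fBot).
  apply/(@pcard_injP _ U); exists f => m n _ _.
  elim: m n => [|m ih] [|n] //= [] /ih -> //.
have AL : [set: A] #<= [set: sentence L] := card_le_trans cA natL.
split; first exact: card_le_trans AL LK.
by move=> KA; apply: KL; exact: card_le_trans KA AL.
Qed.

Section Limit.
Variables (L : signature) (N : structure L).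

Section ExList.
Variables (V : eqType) (sv : V -> lsort L).

(** Variable [i] of [p] becomes the new variable [None]; the old variable [i]
    stays in the context, where it no longer occurs. *)
Definition bind_var (i : V) (p : formula sv) : formula (ext sv (sv i)) :=
  fsub p (dfwith (fun x => @tVar L _ (ext sv (sv i)) (Some x))
                 (@tVar L _ (ext sv (sv i)) None)).

Lemma sat_bind_var i p (u : tuple_of N sv) (b : N (sv i)) :
  sat (snoc u b) (bind_var i p) <-> sat (dfwith u b) p.
Proof.
rewrite (propext (sat_fsub _ _ _)).
suff -> : (fun x => teval (snoc u b)
   (dfwith (fun x => @tVar L _ (ext sv (sv i)) (Some x))
                 (@tVar L _ (ext sv (sv i)) None) x)) = dfwith u b by [].
apply: functional_extensionality_dep => x.
have [<-|ix] := eqVneq i x; first by rewrite !dfwith_in.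
by rewrite !dfwith_out.
Qed.

Definition ex_list (r : seq V) (p : formula sv) : formula sv :=
  foldr (fun i q => fEx (bind_var i q)) p r.

Lemma sat_ex_list_cons i r p (u : tuple_of N sv) :
  sat u (ex_list (i :: r) p) <->
  exists b : N (sv i), sat (dfwith u b) (ex_list r p).
Proof.
rewrite (propext (sat_fEx _ _)).
by split=> -[b hb]; exists b; [apply/sat_bind_var | apply/sat_bind_var].
Qed.

Lemma sat_ex_list_intro r p (u w : tuple_of N sv) :
  (forall x, x \notin r -> w x = u x) -> sat w p -> sat u (ex_list r p).
Proof.
move=> + hp; elim: r u => [|i r ih] u hw.
  suff -> : u = w by [].
  by apply: functional_extensionality_dep => x; rewrite hw.
apply/sat_ex_list_cons; exists (w i); apply: ih => x xr.
have [<-|ix] := eqVneq i x; first by rewrite dfwith_in.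
by rewrite dfwith_out // hw // inE negb_or eq_sym ix.
Qed.

Lemma sat_ex_list_mono r p q (u : tuple_of N sv) :
  (forall v : tuple_of N sv, sat v p -> sat v q) ->
  sat u (ex_list r p) -> sat u (ex_list r q).
Proof.
move=> pq; elim: r u => [|i r ih] u; first exact: pq.
by move/sat_ex_list_cons=> [b /ih hb]; apply/sat_ex_list_cons; exists b.
Qed.

End ExList.

(** A set of formulas closed under conjunction is finitely satisfiable as soon
    as each of its members is satisfiable: a finite part of its image under [f]
    follows from the image of a single member. *)
Lemma conj_of_finite V (sv : V -> lsort L) (P : set (formula sv)) T
    (f : formula sv -> T) (S : set T) :
  P (fNot fBot) -> (forall p q, P p -> P q -> P (fAnd p q)) ->
  finite_set S -> S `<=` f @` P ->
  exists2 q, P q & forall t, S t ->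
    exists2 q', t = f q' & forall v : tuple_of N sv, sat v q -> sat v q'.
Proof.
move=> PT PI; elim/Peq: T => T in f S *.
move=> /finite_seqP[s ->] {S}; elim: s => [|t s ih] sP.
  by exists (fNot fBot).
have [q Pq hq] : exists2 q, P q & forall t', [set` s] t' ->
    exists2 q', t' = f q' & forall v : tuple_of N sv, sat v q -> sat v q'.
  by apply: ih => t' t's; apply: sP; rewrite /= inE t's orbT.
have [q' Pq' ft] : (f @` P) t by apply: sP; rewrite /= mem_head.
exists (fAnd q' q); first exact: PI.
move=> t'; rewrite /= inE => /predU1P[->|/hq[q'' -> h]].
  by exists q' => // v /sat_fAnd[].
by exists q'' => // v /sat_fAnd[_ /h].
Qed.

(** Saturation in finitely many variables at once, applied to the formulas that
    hold eventually along a sequence. Saturation in one variable is used for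
    the variables of [D] one after the other, keeping as invariant that
    every eventual formula remains true once the variables not yet treated are
    quantified existentially. *)
Lemma limit_tuple (K : Type) (V : Type) (sv : V -> lsort L)
    (u_ : nat -> tuple_of N sv) (u0 : tuple_of N sv) (D : set V) :
  saturated K N -> smaller V K -> finite_set D ->
  (forall k x, ~ D x -> u_ k x = u0 x) ->
  exists2 u : tuple_of N sv, (forall x, ~ D x -> u x = u0 x) &
    forall q, (\forall k \near \oo, sat (u_ k) q) -> sat u q.
Proof.
move=> satN VK; elim/Peq: V => V in sv u_ u0 D VK *.
move=> /finite_seqP[r0 ->] hu.
pose ev q := \forall k \near \oo, sat (u_ k) q.
have evI p q : ev p -> ev q -> ev (fAnd p q).
  by apply: filterS2 => k hp hq; apply/sat_fAnd.
(* [r] lists the variables whose value has not been chosen yet. *)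
have step r : {subset r <= r0} -> forall u : tuple_of N sv,
    (forall x, x \notin r0 -> u x = u0 x) ->
    (forall q, ev q -> sat u (ex_list r q)) ->
    exists2 u : tuple_of N sv, (forall x, x \notin r0 -> u x = u0 x) &
    (forall q, ev q -> sat u q).
  elim: r => [_ u|i r ih ir u uu0 hq]; first by exists u.
  have [b hb] : exists b : N (sv i), forall p,
      [set bind_var i (ex_list r q) | q in ev] p -> sat (snoc u b) p.
    apply: satN => // p0 p0ev p0fin.
    have [|q evq qp0] := conj_of_finite _ evI p0fin p0ev.
      by apply: nearW => k h; exact: h.
    have /sat_ex_list_cons[b hb] := hq q evq.
    exists b => p /qp0[q' -> qq']; apply/sat_bind_var.
    exact: sat_ex_list_mono qq' hb.
  apply: (ih _ (dfwith u b)) => [x xr|x xr0|q evq].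
  - by apply: ir; rewrite inE xr orbT.
  - rewrite dfwith_out ?uu0 //; apply: contraNneq xr0 => <-.
    by apply: ir; rewrite inE eqxx.
  - by apply/sat_bind_var; apply: hb; exists q.
have [||u uu0 hq] := step r0 (fun _ => id) u0 => //; last first.
  by exists u => // x /negP xr; apply: uu0.
move=> q [k _ /(_ k (leqnn k)) hk].
by (* Before any choice, a single [u_ k] satisfying [q] is enough. *)
apply: sat_ex_list_intro hk => x xr; apply: hu; exact/negP.
Qed.
End Limit.

Lemma countable_sum A B :
  countable [set: A] -> countable [set: B] -> countable [set: A + B].
Proof. by move=> /Pcountable[A' ->] /Pcountable[B' ->]. Qed.

Lemma finite_sum A B :
  finite_set [set: A] -> finite_set [set: B] -> finite_set [set: A + B].
Proof.
move=> fA fB; suff -> : [set: A + B] = range inl `|` range inr.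
  by rewrite finite_setU; split; exact: finite_image.
by apply/seteqP; split=> // -[x|x] _; [left | right]; exists x.
Qed.

Section LimitAut.
Variables (L : signature) (N : structure L).

Definition sum_sort V W (sv : V -> lsort L) (sw : W -> lsort L) :
  V + W -> lsort L := fun o => match o with inl x => sv x | inr y => sw y end.

Definition cat_tuple V W (sv : V -> lsort L) (sw : W -> lsort L)
    (a : tuple_of N sv) (b : tuple_of N sw) : tuple_of N (sum_sort sv sw) :=
  fun o => match o with inl x => a x | inr y => b y end.

Definition pair_terms V (sv : V -> lsort L) W (sw : W -> lsort L)
    (s t : forall x, term sw (sv x)) : forall o, term sw (twice sv o) :=
  fun o => match o with inl x => s x | inr x => t x end.

Lemma sat_pair_terms V (sv : V -> lsort L) W (sw : W -> lsort L)
    (s t : forall x, term sw (sv x)) (v : tuple_of N sw)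
    (q : formula (twice sv)) :
  sat v (fsub q (pair_terms s t)) <->
  sat (pair_up (fun x => teval v (s x)) (fun x => teval v (t x))) q.
Proof.
rewrite (propext (sat_fsub _ _ _)).
suff -> : (fun x => teval v (pair_terms s t x)) =
  pair_up (fun x => teval v (s x)) (fun x => teval v (t x)) by [].
by apply: functional_extensionality_dep => -[].
Qed.

(** A limit of the tuples [g k b] has the type of [b], so strong homogeneity
    turns it into the image of [b] under an automorphism. The relations between
    this image and the parameters [p], which the [g k] need not fix, are those
    that hold eventually. *)
Lemma limit_automorphism (T : set (sentence L)) (K : Type) J B
    (sJ : J -> lsort L) (sB : B -> lsort L)
    (p : tuple_of N sJ) (b : tuple_of N sB) (g : nat -> forall s, N s -> N s) :
  monster T K N -> countable [set: J] -> finite_set [set: B] ->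
  (forall k, Aut N (g k)) ->
  exists2 f, Aut N f & forall q : formula (sum_sort sJ sB),
    (\forall k \near \oo, sat (cat_tuple p (tuple_map (g k) b)) q) ->
    sat (cat_tuple p (tuple_map f b)) q.
Proof.
move=> [_ LK satN homN] cJ finB autg.
have cB := finite_set_countable finB.
have cV := countable_sum cJ cB.
have fD : finite_set (range (@inr J B)) by exact: finite_image.
have [|u uu0 ulim] := limit_tuple (u_ := fun k => cat_tuple p (tuple_map (g k) b))
    (u0 := cat_tuple p b) satN (countable_smaller LK cV) fD.
  by move=> k [x|x] //= []; exists x.
pose b' : tuple_of N sB := fun x => u (inr x).
have uE : u = cat_tuple p b'.
  by apply: functional_extensionality_dep => -[x|//]; apply: uu0 => -[].
have b'P q : sat b q -> sat b' q.
  move=> bq; pose q' := fsub q (fun x => tVar (sum_sort sJ sB) (inr x)).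
  suff /sat_fsub : sat u q' by [].
  by apply: ulim; apply: nearW => k; apply/sat_fsub/sat_aut.
have [|f autf fb] := homN _ _ b b' (countable_smaller LK cB).
  move=> q; split; first exact: b'P.
  by apply: contraPP => nq; exact: (b'P (fNot q)).
by exists f => // q /ulim; rewrite uE fb.
Qed.

(** If the [g k] tend to fix [e], and the classes of the tuples [g k a], where
    [a] represents [d], were pairwise distinct, a limit of the [g k] would fix
    [e] and send [d] away from each of the countably many [F n] that enumerate
    its images over [e]. Being definable, the equivalence relation of [d] can
    be negated by a formula, which is how the limit remembers to avoid
    [F n]. *)
Lemma acl_imaginary_recurs (T : set (sentence L)) (K : Type)
    (e d : hyperimaginary N) (g : nat -> forall s, N s -> N s) :
  monster T K N -> finite_set [set: hidx e] ->
  (forall k, Aut N (g k)) ->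
  (forall q, hrel e q -> \forall k \near \oo,
     sat (pair_up (tuple_map (g k) (htuple e)) (htuple e)) q) ->
  acl e d -> Meq N d ->
  exists j k, (j < k)%N /\
    type_rel (hrel d) (tuple_map (g j) (htuple d)) (tuple_map (g k) (htuple d)).
Proof.
move=> monN fine autg ge [_ find] [fI [phi phiE]]; apply: contrapT => nojk.
have [r s t] := hequiv d.
set S := [set himage f d | f in _] in find.
have Sid : S (hclass d).
  by exists (fun=> id) => //; split=> //; exact: aut_id.
have /pfcard_geP[S0|[F]] := finite_set_countable find.
  by rewrite S0 in Sid.
have /choice[h hE] : forall n, exists f, Aut_over e f /\ himage f d = F n.
  move=> n; have [f ef fE] : S (F n) by exact: funS.
  by exists f.
(* The parameters are [c] and, for each [n], the tuple [h n a] representing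
   the [n]-th image of [d]. *)
pose c := htuple e; pose a := htuple d.
pose sF (x : nat * hidx d) := hsort d x.2.
pose p : tuple_of N (sum_sort (hsort e) sF) :=
  cat_tuple c (fun x => h x.1 _ (a x.2)).
have cJ : countable [set: hidx e + nat * hidx d].
  apply: countable_sum; first exact: finite_set_countable.
  by rewrite -setXTT; apply: countableX => //; exact: finite_set_countable.
have fB := finite_sum fine fI.
have [f autf flim] := limit_automorphism p (cat_tuple c a) monN cJ fB autg.
pose V := sum_sort (sum_sort (hsort e) sF) (sum_sort (hsort e) (hsort d)).
have ef : Aut_over e f.
  split=> //; apply/fixesE => q /ge near_q.
  pose q' := fsub q (pair_terms (fun x => tVar V (inr (inl x)))
                                (fun x => tVar V (inl (inl x)))).
  suff /sat_pair_terms : sat (cat_tuple p (tuple_map f (cat_tuple c a))) q' by [].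
  apply: flim; apply: filterS near_q => k hk; exact/sat_pair_terms.
have [n _ fn] : range F (himage f d).
  by apply: surj; exists f.
have [_ hn] := hE n.
have : type_rel (hrel d) (tuple_map f a) (tuple_map (h n) a).
  by apply/himage_eq; rewrite hn fn.
pose q' := fsub phi (pair_terms (fun x => tVar V (inr (inr x)))
                                (fun x => tVar V (inl (inr (n, x))))).
suff nq : sat (cat_tuple p (tuple_map f (cat_tuple c a))) (fNot q').
  by move=> /phiE fhn; apply: nq; exact/sat_pair_terms.
apply: flim.
(* At most one [g k a] lies in the [n]-th class. *)
have [[k0 hk0]|nk] := pselect (exists k0,
    type_rel (hrel d) (tuple_map (g k0) a) (tuple_map (h n) a)).
  near=> k; move=> /sat_pair_terms/phiE hk; apply: nojk.
  exists k0, k; split; last exact: t hk0 (s _ _ hk).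
  by near: k; exact: nbhs_infty_gt.
by apply: nearW => k; move=> /sat_pair_terms/phiE hk; apply: nk; exists k.
Unshelve. all: by end_near.
Qed.
End LimitAut.

(** * The circles *)

Definition delta (N : structure circle_sig) (x : N One) : N Two :=
  @fint circle_sig N Cover (fun=> x).

Definition delta_term V (sv : V -> circle_sort)
    (x : @term circle_sig V sv One) : @term circle_sig V sv Two :=
  @tApp circle_sig V sv Cover (fun=> x).

Section StandardCircle.
Local Open Scope ring_scope.
Variable R : realType.
Let M := circle_structure R.

Lemma rotC i m n (x : M i) : rot m (rot n x) = rot n (rot m x).
Proof.
have [t ->] := at_angle_ex x.
by rewrite /rot /= !rotate_at; congr at_angle; ring.
Qed.

(** The index [m.*2.+1] stands for the angle [2 pi / (2 m + 2)], half of that of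
    the index [m]; hence also the form of [delta_rot]. *)
Lemma rot_twice i m (x : M i) : rot m.*2.+1 (rot m.*2.+1 x) = rot m x.
Proof.
have [t ->] := at_angle_ex x.
rewrite /rot /= !rotate_at; congr at_angle.
have -> : m.*2.+2 = (m.+1 * 2)%N by rewrite muln2 doubleS.
have m0 : m.+1%:R != 0 :> R by rewrite pnatr_eq0.
by rewrite natrM; field; rewrite nat1r.
Qed.

Lemma rot0 i (x : M i) : rot 0 x = x.
Proof.
have [t ->] := at_angle_ex x.
by rewrite /rot /= rotate_at divr1 -at_angleD2pi subrK.
Qed.

Lemma delta_rot m (x : M One) :
  delta (rot m.*2.+1 x) = rot m (delta x) :> M Two.
Proof.
have [t ->] := at_angle_ex x.
rewrite /rot /delta /= rotate_at !double_at rotate_at; congr at_angle.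
have -> : m.*2.+2 = (m.+1 * 2)%N by rewrite muln2 doubleS.
have m0 : m.+1%:R != 0 :> R by rewrite pnatr_eq0.
by rewrite natrM; field; rewrite nat1r.
Qed.

Lemma delta_surj (y : M Two) : exists x : M One, delta x = y.
Proof.
have [t ->] := at_angle_ex y; exists (at_angle (t / 2)).
by rewrite /delta /= double_at; congr at_angle; field.
Qed.

Lemma cw_rotate w (b c d : circle R) :
  clockwise b c d -> clockwise (rotate w b) (rotate w c) (rotate w d).
Proof.
move=> [t [u [v [u0 uv v2 [-> -> ->]]]]]; exists (t - w), u, v.
by split=> //; rewrite !rotate_at; split=> //; congr at_angle; ring.
Qed.

Lemma cw_rot i m (a b c : M i) : cw a b c <-> cw (rot m a) (rot m b) (rot m c).
Proof.
split; first exact: cw_rotate.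
have rK p : rotate (- (2 * pi / m.+1%:R)) (rotate (2 * pi / m.+1%:R) p) = p.
  by have [t ->] := at_angle_ex p; rewrite !rotate_at opprK subrK.
move=> /(cw_rotate (- (2 * pi / m.+1%:R))).
by rewrite /cw /rot /= !rK.
Qed.

Lemma close_rot i k m (x : M i) : (k.+1 < m)%N -> close k (rot m x) x.
Proof.
move=> km; have [t ->] := at_angle_ex x.
have p0 := pi_gt0 R.
apply/closeP; exists (t - 2 * pi / m.+1%:R), (- (2 * pi / m.+1%:R)); split.
- rewrite normrN gtr0_norm ?divr_gt0 ?mulr_gt0 //.
  by rewrite ltr_pM2l ?mulr_gt0 // ltf_pV2 ?posrE // ltr_nat.
- by rewrite /rot /= rotate_at.
- by rewrite opprK subrK.
Qed.

Lemma double_cover_fiber (p q : circle R) : double_cover p = double_cover q ->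
  p = q \/ p = rotate pi q.
Proof.
case: p q => [[x y] hp] [[x' y'] hq].
have /eqP /= h := hp; have /eqP /= h' := hq.
move=> /(congr1 val) /= [e1 e2].
have exx : (x - x') * (x + x') = 0 by rewrite -subr_sqr; nra.
have eyy : (y - y') * (y + y') = 0 by rewrite -subr_sqr; nra.
suff [[ex ey]|[ex ey]] : (x = x' /\ y = y') \/ (x = - x' /\ y = - y').
- by left; apply: val_inj; rewrite /= ex ey.
- right; apply: val_inj.
  by rewrite /= /rotate_pt /= cospi sinpi ex ey; congr pair; ring.
move/eqP: exx; rewrite mulf_eq0 subr_eq0 addr_eq0.
move/eqP: eyy; rewrite mulf_eq0 subr_eq0 addr_eq0.
move=> /orP[] /eqP ey /orP[] /eqP ex; subst x y; first by left.
- have xy : x' * y' = 0 by lra.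
  have /eqP := xy; rewrite mulf_eq0 => /orP[] /eqP z0; subst.
    by left; rewrite oppr0.
  by right; rewrite oppr0.
- have xy : x' * y' = 0 by lra.
  have /eqP := xy; rewrite mulf_eq0 => /orP[] /eqP z0; subst.
    by right; rewrite oppr0.
  by left; rewrite oppr0.
- by right.
Qed.

(** Two angles that agree after doubling, up to [u], agree up to [u / 2] and
    possibly a half turn. The two bounds [k] and [l] are independent, so
    that, over all [k] and [l], one of the alternatives holds for every bound. *)
Lemma close_lift k l (x y : M One) :
  close (maxn k l) (delta x : M Two) (delta y) ->
  close k x y \/ close l x (rot 1 y).
Proof.
have [t ->] := at_angle_ex x.
move=> /closeP[t' [u [hu]]]; rewrite /delta /= double_at => e1 e2.
have {e1 e2} : double_cover (at_angle (t - u / 2)) = double_cover y.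
  have e3 : at_angle (2 * t - u) = at_angle (t' - u).
    by rewrite -!rotate_at e1.
  by rewrite double_at e2 -e3; congr at_angle; field.
have p0 := pi_gt0 R.
have hu2 j : (j <= maxn k l)%N -> `|u / 2| < 2 * pi / j.+2%:R.
  move=> jm; apply: (@le_lt_trans _ _ `|u|).
    by rewrite normrM [`|2^-1|]gtr0_norm ?invr_gt0 // ler_piMr // invf_le1 // ler1n.
  apply: (lt_le_trans hu); rewrite ler_pM2l ?mulr_gt0 // lef_pV2 ?posrE //.
  by rewrite ler_nat.
move=> /double_cover_fiber[yE|yE]; [left | right].
  by apply/closeP; exists t, (u / 2); split=> //; rewrite hu2 ?leq_maxl.
apply/closeP; exists t, (u / 2); rewrite hu2 ?leq_maxr //; split=> //.
rewrite yE /rot /=; congr rotate; lra.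
Qed.

Lemma antipode_not_close (x : M One) : ~ close 0 (rot 1 x) x.
Proof.
have p0 := pi_gt0 R.
move=> /closeP[t [u [hu /= e1 e2]]].
apply: (@at_angle_inj0 R t (u + pi)).
  by move: hu; rewrite ltr_norml; lra.
rewrite -e1 e2 /rot /= rotate_at; congr at_angle; lra.
Qed.

End StandardCircle.

(** * Transfer to the models of the theory of the circles *)

Section Transfer.
Variables (R : realType) (N : structure circle_sig).
Hypothesis hN : models (Th (circle_structure R)) N.

Let ctx1 (i : circle_sort) := ext (@no_sort circle_sig) i.
Let ctx2 (i : circle_sort) := ext (ctx1 i) i.
Let ctx3 (i : circle_sort) := ext (ctx2 i) i.

Lemma model_rotC i m n (x : N i) : rot m (rot n x) = rot n (rot m x).
Proof.
pose v := @tVar circle_sig _ (ctx1 i) None.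
exact: (hN (p := @fAll circle_sig _ _ i
  (fEq (rot_term m (i := i) (rot_term n (i := i) v))
       (rot_term n (i := i) (rot_term m (i := i) v))))
  (@rotC R i m n) x).
Qed.

Lemma model_rot_twice i m (x : N i) : rot m.*2.+1 (rot m.*2.+1 x) = rot m x.
Proof.
pose v := @tVar circle_sig _ (ctx1 i) None.
exact: (hN (p := @fAll circle_sig _ _ i
  (fEq (rot_term m.*2.+1 (i := i) (rot_term m.*2.+1 (i := i) v))
       (rot_term m (i := i) v)))
  (@rot_twice R i m) x).
Qed.

Lemma model_rot0 i (x : N i) : rot 0 x = x.
Proof.
pose v := @tVar circle_sig _ (ctx1 i) None.
exact: (hN (p := @fAll circle_sig _ _ i (fEq (rot_term 0 (i := i) v) v))
  (@rot0 R i) x).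
Qed.

Lemma model_delta_rot m (x : N One) : delta (rot m.*2.+1 x) = rot m (delta x).
Proof.
pose v := @tVar circle_sig _ (ctx1 One) None.
exact: (hN (p := @fAll circle_sig _ _ One
  (fEq (delta_term (rot_term m.*2.+1 (i := One) v))
       (rot_term m (delta_term v))))
  (@delta_rot R m) x).
Qed.

Lemma model_delta_surj (y : N Two) : exists x : N One, delta x = y.
Proof.
pose sv := ext (ctx1 Two) One.
pose p : formula (ctx1 Two) := @fEx circle_sig _ _ One
  (fEq (delta_term (@tVar circle_sig _ sv None))
       (@tVar circle_sig _ sv (Some None))).
have /hN/(_ y) h : true_in (circle_structure R) (@fAll circle_sig _ _ Two p).
  by move=> z; apply/sat_fEx; have [x hx] := delta_surj z; exists x.
by have /sat_fEx : sat (snoc (empty_tuple N) y) p := h.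
Qed.

Lemma model_cw_rot i m (a b c : N i) :
  cw a b c <-> cw (rot m a) (rot m b) (rot m c).
Proof.
pose x := @tVar circle_sig _ (ctx3 i) (Some (Some None)).
pose y := @tVar circle_sig _ (ctx3 i) (Some None).
pose z := @tVar circle_sig _ (ctx3 i) None.
pose p := @clockwise_fm _ (ctx3 i) i x y z.
pose q := clockwise_fm (rot_term m (i := i) x) (rot_term m (i := i) y)
                          (rot_term m (i := i) z).
pose all3 r : sentence circle_sig :=
  @fAll circle_sig _ _ i (@fAll circle_sig _ _ i (@fAll circle_sig _ _ i r)).
have pE (S : structure circle_sig) (a' b' c' : S i) :
    sat (snoc (snoc (snoc (empty_tuple S) a') b') c') p <-> cw a' b' c'.
  exact: sat_clockwise_fm.
have qE (S : structure circle_sig) (a' b' c' : S i) :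
    sat (snoc (snoc (snoc (empty_tuple S) a') b') c') q <->
    cw (rot m a') (rot m b') (rot m c').
  exact: sat_clockwise_fm.
split=> h.
  have /hN/(_ a b c) pq : true_in (circle_structure R) (all3 (fImp p q)).
    by move=> a' b' c' h'; apply: (qE _ a' b' c').2;
       apply: (cw_rot m a' b' c').1; exact: (pE _ a' b' c').1.
  by apply: (qE _ a b c).1; apply: pq; exact: (pE _ a b c).2.
have /hN/(_ a b c) qp : true_in (circle_structure R) (all3 (fImp q p)).
  by move=> a' b' c' h'; apply: (pE _ a' b' c').2;
     apply: (cw_rot m a' b' c').2; exact: (qE _ a' b' c').1.
by apply: (pE _ a b c).1; apply: qp; exact: (qE _ a b c).2.
Qed.

Lemma model_close_rot i k m (x : N i) : (k.+1 < m)%N -> close k (rot m x) x.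
Proof.
move=> km; pose v := @tVar circle_sig _ (ctx1 i) None.
have /hN/(_ x) h : true_in (circle_structure R)
    (@fAll circle_sig _ _ i (close_fm (i := i) k (rot_term m (i := i) v) v)).
  by move=> y; apply/sat_close_fm; exact: close_rot.
exact: (sat_close_fm (snoc (empty_tuple N) x) _ _ _).1 h.
Qed.

Lemma model_antipode_not_close (x : N One) : ~ close 0 (rot 1 x) x.
Proof.
pose v := @tVar circle_sig _ (ctx1 One) None.
pose p := close_fm (i := One) 0 (rot_term 1 (i := One) v) v.
have /hN/(_ x) h : true_in (circle_structure R)
    (@fAll circle_sig _ _ One (fNot p)).
  by move=> y /sat_close_fm; exact: antipode_not_close.
by move=> hx; apply: h; apply/sat_close_fm.
Qed.

Lemma model_close_lift k l (x y : N One) :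
  close (maxn k l) (delta x) (delta y) -> close k x y \/ close l x (rot 1 y).
Proof.
pose sv := ctx2 One.
pose u := @tVar circle_sig _ sv (Some None).
pose v := @tVar circle_sig _ sv None.
pose p := close_fm (i := Two) (maxn k l) (delta_term u) (delta_term v).
pose q := fOr (close_fm (i := One) k u v)
              (close_fm (i := One) l u (rot_term 1 (i := One) v)).
have pE (S : structure circle_sig) (x' y' : S One) :
    sat (snoc (snoc (empty_tuple S) x') y') p <->
    close (maxn k l) (delta x') (delta y').
  exact: sat_close_fm.
have qE (S : structure circle_sig) (x' y' : S One) :
    sat (snoc (snoc (empty_tuple S) x') y') q <->
    close k x' y' \/ close l x' (rot 1 y').
  by rewrite (propext (sat_fOr _ _ _)) !(propext (sat_close_fm _ _ _ _)).
have /hN/(_ x y) pq : true_in (circle_structure R)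
    (@fAll circle_sig _ _ One (@fAll circle_sig _ _ One (fImp p q))).
  move=> x' y' h; apply: (qE _ x' y').2; apply: close_lift.
  exact: (pE _ x' y').1.
by move=> h; apply: (qE _ x y).1; apply: pq; exact: (pE _ x y).2.
Qed.

End Transfer.

(** * Rotations by dyadic fractions of a turn *)

Section Turns.
Variables (R : realType) (N : structure circle_sig).
Hypothesis hN : models (Th (circle_structure R)) N.

(** The angle is [2 pi / 2 ^ (k + 1)] on the first circle and [2 pi / 2 ^ k] on
    the second, as the covering doubles angles. For [k = 0] the index on the
    second circle is that of the full turn, which is the identity. *)
Definition turn_index (s : circle_sort) (k : nat) : nat :=
  match s with One => (2 ^ k.+1).-1 | Two => (2 ^ k).-1 end.

Definition turn (k : nat) (s : lsort circle_sig) : N s -> N s :=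
  @rot N s (turn_index s k).

Lemma turn_indexS s k : turn_index s k.+1 = (turn_index s k).*2.+1.
Proof.
have h n : (2 ^ n.+1).-1 = (2 ^ n).-1.*2.+1.
  have : 0 < 2 ^ n by rewrite expn_gt0.
  by rewrite expnS mul2n; case: (2 ^ n).
by case: s => /=; rewrite h.
Qed.

Lemma turnS k s (x : N s) : turn k.+1 (turn k.+1 x) = turn k x.
Proof. by rewrite /turn turn_indexS; exact: (model_rot_twice hN). Qed.

Lemma turn0 s (x : N s) : turn 0 (turn 0 x) = x.
Proof.
case: s x => x; last by rewrite /turn !(model_rot0 hN).
exact: etrans (model_rot_twice hN 0 x) (model_rot0 hN x).
Qed.

Lemma turnC j k s (x : N s) : turn j (turn k x) = turn k (turn j x).
Proof. exact: (model_rotC hN). Qed.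

(** Bijectivity follows from [turn0] and [turnS]: a map whose square is
    bijective is bijective. *)
Lemma turn_aut k : Aut N (turn k).
Proof.
split.
- elim: k => [s|k ih s].
    by exists (@turn 0 s); exact: turn0.
  have [h hK Kh] := ih s.
  exists (fun x => h (turn k.+1 x)) => x; first by rewrite turnS hK.
  have inj : injective (@turn k.+1 s).
    by apply: (can_inj (g := fun x => h (turn k.+1 x))) => y; rewrite turnS hK.
  by apply: (inj); rewrite turnS Kh.
- move=> [i m|] a.
    have -> : a = fun=> a ord0.
      by apply: functional_extensionality_dep => j; rewrite (ord1 j).
    exact: (model_rotC hN (turn_index i k) m (a ord0)).
  have -> : a = fun=> a ord0.
    by apply: functional_extensionality_dep => j; rewrite (ord1 j).
  have := model_delta_rot hN (turn_index Two k) (a ord0).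
  by rewrite -turn_indexS => /esym.
- move=> s a.
  have aE (b : forall i : 'I_3, N s) : b = fun j => match val j with
      | 0 => b (@Ordinal 3 0 isT)
      | 1 => b (@Ordinal 3 1 isT)
      | _ => b (@Ordinal 3 2 isT) end.
    by apply: functional_extensionality_dep => -[[|[|[|m]]] hm] //=;
      congr b; exact: val_inj.
  rewrite (aE a) [X in _ <-> rint X]aE.
  exact: (model_cw_rot hN (turn_index s k)).
Qed.

Lemma turn_map0 V (sv : V -> circle_sort) (a : @tuple_of circle_sig N V sv) :
  tuple_map (turn 0) (tuple_map (turn 0) a) = a.
Proof. by apply: functional_extensionality_dep => x; exact: turn0. Qed.

Lemma turn_mapS k V (sv : V -> circle_sort) (a : @tuple_of circle_sig N V sv) :
  tuple_map (turn k.+1) (tuple_map (turn k.+1) a) = tuple_map (turn k) a.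
Proof. by apply: functional_extensionality_dep => x; exact: turnS. Qed.

Lemma turn_mapC j k V (sv : V -> circle_sort) (a : @tuple_of circle_sig N V sv) :
  tuple_map (turn j) (tuple_map (turn k) a) =
  tuple_map (turn k) (tuple_map (turn j) a).
Proof. by apply: functional_extensionality_dep => x; exact: turnC. Qed.

Lemma turn_close k m (x : N Two) : (m.+1 < k)%N -> close m (turn k x) x.
Proof.
move=> mk; apply: (model_close_rot hN).
have := ltn_expl k (isT : 1 < 2); rewrite /turn_index.
by case: (2 ^ k) => // n; rewrite ltnS; exact: leq_trans.
Qed.

(** Squaring lowers both indices by one: if the commuting automorphisms [i] and
    [turn l] send [a] to equivalent tuples, so do their squares. After [j + 1]
    squarings the left side is [a] itself, and then the right index can be
    lowered to 0. *)
Lemma recurs_fixed (d : hyperimaginary N) j k : (j < k)%N ->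
  type_rel (hrel d) (tuple_map (turn j) (htuple d))
    (tuple_map (turn k) (htuple d)) ->
  fixes (turn 0) d.
Proof.
have [_ sy tr] := hequiv d; set a := htuple d => jk.
have square i l : type_rel (hrel d) (tuple_map i a) (tuple_map (turn l) a) ->
    Aut N i ->
    tuple_map i (tuple_map (turn l) a) = tuple_map (turn l) (tuple_map i a) ->
    type_rel (hrel d) (tuple_map i (tuple_map i a))
      (tuple_map (turn l) (tuple_map (turn l) a)).
  move=> h auti il; apply: (tr _ (tuple_map i (tuple_map (turn l) a))).
    exact/type_rel_aut.
  by rewrite il; apply/type_rel_aut => //; exact: turn_aut.
have [m a_m] : exists m, j + m.+1 = k
  by exists (k - j.+1); rewrite addnS -addSn subnKC.
rewrite -a_m => {k jk a_m} h.
have {j}h : type_rel (hrel d) a (tuple_map (turn m) a).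
  elim: j h => [|j ih] /square.
    by rewrite turn_map0 add0n turn_mapS; apply; [exact: turn_aut|exact: turn_mapC].
  rewrite addSn !turn_mapS => h; apply: ih; apply: h; [exact: turn_aut|exact: turn_mapC].
apply/fixesE/sy; elim: m h => // m ih /(square (fun=> id)).
by rewrite turn_mapS => h; apply: ih; apply: h => //; exact: aut_id.
Qed.

End Turns.

(** * The separation *)

Theorem mainTheorem4 (R : realType) (K : Type) (N : structure circle_sig)
    (hN : monster (Th (circle_structure R)) K N) (c : N Two) :
  let e := infinitesimal_class (monster_models hN) c in
  ~ interdefinable (acl e) (acleq e).
Proof.
move=> e /(_ (@turn N 0) (turn_aut (monster_models hN) 0)) [_ h].
have mN := monster_models hN.
have [b deltab] := model_delta_surj mN c.
pose eb := infinitesimal_class mN b.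
(* Its images over [e] are its own class and that of the antipode of [b]. *)
have aclb : acl e eb.
  split; first exact: (@countableP unit).
  apply: (@sub_finite_set _ _ [set himage (fun=> id) eb; himage (turn 0) eb]);
    last exact: finite_set2.
  move=> _ [f [autf /fixesE /type_rel_inf_close /= fe] <-].
  have lift k l : close k (f _ b) b \/ close l (f _ b) (turn 0 b).
    apply: (model_close_lift mN).
    have [_ ff _] := autf.
    have -> : delta (f One b) = f Two c.
      by rewrite -deltab; exact: esym (ff Cover (fun=> b)).
    by rewrite deltab; exact: fe.
  have [ka|/existsNP[k nk]] := pselect (forall k, close k (f _ b) b);
    [left | right];
    apply/(himage_eq f _ eb).2/type_rel_inf_close => //= l.
  by case: (lift k l).
have : fixes (turn 0) eb.
  apply: h aclb => d [->|[acld meqd]].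
    apply/fixesE/type_rel_inf_close => k; apply: Or31.
    exact: (model_rot0 mN).
  have [||j [k [jk jkd]]] :=
    acl_imaginary_recurs hN _ (turn_aut mN) _ acld meqd.
  - exact: finite_finset.
  - move=> _ [m _ <-]; near=> k; apply/sat_close_fm.
    apply: (turn_close mN); near: k; exact: nbhs_infty_gt.
  - exact: (recurs_fixed mN jk).
move=> /fixesE/type_rel_inf_close /(_ 0).
exact: (model_antipode_not_close mN).
Unshelve. all: by end_near.
Qed.
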